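(* Let $I$ be an ideal of $Di[X]$ and $>$ a monomial-center ordering on $\lfloor X^+\rfloor_1\cup\lfloor XX\rfloor_2$. Then there exists a unique reduced Gröbner--Shirshov basis for $I$.
   Context: Fix a field $\mathbf{k}$. A commutative dialgebra is a $\mathbf{k}$-linear space with two bilinear operations $\vdash,\dashv$, each associative and commutative, satisfying $a\dashv(b\vdash c)=a\dashv(b\dashv c)$, $(a\dashv b)\vdash c=(a\vdash b)\vdash c$, $a\vdash(b\dashv c)=(a\vdash b)\dashv c$. An ideal is a subspace closed under multiplication (by $\vdash$ and by $\dashv$) with arbitrary elements; $Id(S)$ is the ideal generated by $S$. Let $X$ be a totally ordered set, $\lfloor X^+\rfloor$ the free commutative semigroup without unit on $X$ (elements $\lfloor u\rfloor$, length $|u|$), $\lfloor X^*\rfloor=\lfloor X^+\rfloor\cup\{\varepsilon\}$ the free commutative monoid. Let $\lfloor X^+\rfloor_1=\{\lfloor u\rfloor_1\mid\lfloor u\rfloor\in\lfloor X^+\rfloor\}$ and $\lfloor XX\rfloor_2=\{\lfloor v\rfloor_2\mid\lfloor v\rfloor\in\lfloor X^+\rfloor,|v|=2\}$ (formal symbols); $x\in X$ is identified with $\lfloor x\rfloor_1$. $Di[X]$ is the free commutative dialgebra generated by $X$: the $\mathbf{k}$-space with basis $\lfloor X^+\rfloor_1\cup\lfloor XX\rfloor_2$ and operations: for $x,x'\in X$, $x\dashv x'=\lfloor xx'\rfloor_1$, $x\vdash x'=\lfloor xx'\rfloor_2$; and if $|uv|>2$, $\lfloor u\rfloor_p\vdash\lfloor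 v\rfloor_q=\lfloor u\rfloor_p\dashv\lfloor v\rfloor_q=\lfloor uv\rfloor_1$. Ordering. A monomial ordering on $\lfloor X^+\rfloor$ is a well (total) ordering with $\lfloor u\rfloor>\lfloor v\rfloor\Rightarrow\lfloor uw\rfloor>\lfloor vw\rfloor$. The associated monomial-center ordering on $\lfloor X^+\rfloor_1\cup\lfloor XX\rfloor_2$ is: $\lfloor u\rfloor_m>\lfloor v\rfloor_n$ iff $(\lfloor u\rfloor,m)>(\lfloor v\rfloor,n)$ lexicographically. For nonzero $f\in Di[X]$: $supp(f)$ is the set of basis elements occurring with nonzero coefficient; $\overline f$ its largest element (leading monomial), $lc(f)$ its coefficient; $\widetilde f\in\lfloor X^+\rfloor$ is the word $\lfloor u\rfloor$ if $\overline f=\lfloor u\rfloor_m$; $r_f=f-lc(f)\overline f$. Convention: $\overline 0=\widetilde 0=0$ is smaller than everything. $f$ is monic if $lc(f)=1$; a set is monic if all its elements are. $f\ne0$ is strong if $\widetilde f>\widetilde{r_f}$. Normal polynomials. For a monic set $S$ the normal $S$-polynomials (normal $s$-polynomials, $s\in S$) $\lfloor sb\rfloor_m$ ($\lfloor b\rfloor\in\lfloor X^*\rfloor$, $m\in\{1,2\}$) are: $\lfloor sb\rfloor_m=s$ if $b=\varepsilon$ ($m$ being the index of $\overline s$); $\lfloor sb\rfloor_2=s\vdash b$ if $|\widetilde s|=1$ and $b\in X$; $\lfloor sb\rfloor_1=s\dashv\lfloor b\rfloor_1$ if $s$ is strong and $\lfloor b\rfloor\in\lfloor X^+\rfloor$.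 $Irr(S)$ is the set of elements of $\lfloor X^+\rfloor_1\cup\lfloor XX\rfloor_2$ that are not the leading monomial of any normal $S$-polynomial. Compositions of monic $f,g\in Di[X]$: (i) if $f$ is not strong, for each $x\in X$, $f\vdash x$ and $f\dashv x$; (ii) if $f$ is strong, $|\widetilde f|>1$ and $supp(f)\cap X\ne\emptyset$, for each $x\in X$, $(f\vdash x)-(f\dashv x)$; (iii) if $f\neq g$, $\overline f=\overline g$: $f-g$; (iv) if $|\widetilde f|=2$, $|\widetilde g|=1$ and there is a normal $g$-polynomial $\lfloor gx\rfloor_m$, $x\in X$, with $\overline f=\overline{\lfloor gx\rfloor_m}$: $f-\lfloor gx\rfloor_m$; (v) if $f,g$ are strong, $|\widetilde f|+|\widetilde g|>3$, $\overline f\ne\overline g$: when $\widetilde f=\widetilde g$, for each $x\in X$, $\lfloor fx\rfloor_1-\lfloor gx\rfloor_1$; when $\widetilde f\neq\widetilde g$ and $lcm\{\widetilde f,\widetilde g\}=\lfloor w\rfloor=\lfloor\widetilde fa\rfloor=\lfloor\widetilde gb\rfloor$ with $\lfloor a\rfloor\in\lfloor X^*\rfloor$, $\lfloor b\rfloor\in\lfloor X^+\rfloor$, $|w|<|\widetilde f|+|\widetilde g|$: $\lfloor fa\rfloor_1-\lfloor gb\rfloor_1$. $h\in Di[X]$ is trivial modulo $S$ if $h=\sum_i\alpha_i\lfloor s_ib_i\rfloor_{m_i}$ (finite sum, $\alpha_i\in\mathbf{k}$, normal $S$-polynomials) with $\overline{\lfloor s_ib_i\rfloor_{m_i}}\le\overline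 h$ whenever $\alpha_i\ne0$. A monic set $S$ is a Gröbner--Shirshov basis in $Di[X]$ if every composition of polynomials in $S$ is trivial modulo $S$; it is then called a Gröbner--Shirshov basis for $I=Id(S)$. A Gröbner--Shirshov basis $S$ is reduced if $supp(s)\subseteq Irr(S\setminus\{s\})$ for every $s\in S$. *)

(* Defs.v *)
From HB Require Import structures.
From mathcomp Require Import all_boot all_order all_algebra.
From mathcomp Require Import finmap multiset.
From mathcomp Require Import monalg.
From mathcomp Require Import classical_sets.

Set Implicit Arguments.
Unset Strict Implicit.
Unset Printing Implicit Defensive.

Import Order.TTheory GRing.Theory.
Local Open Scope mset_scope.
Local Open Scope ring_scope.

(* The free commutative monoid on X is {mset X}: [mset0] is the
   empty word, [`+`] the product, [`|`] the lcm and [size] the length. *)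

Section Words.
Context {d : Order.disp_t} {X : orderType d}.

Record word := Word { wmset :> {mset X}; _ : wmset != mset0 }.
HB.instance Definition _ := [isSub for wmset].
HB.instance Definition _ := [Choice of word by <:].

Definition wlen (u : word) : nat := size (wmset u).

Lemma letter_subproof (x : X) : [mset x] != mset0 :> {mset X}.
Proof. by rewrite -size_mset_eq0 enum_msetn. Qed.

Definition letter (x : X) : word := Word (letter_subproof x).

Lemma wmul_subproof (u v : word) : (wmset u `+` wmset v)%mset != mset0.
Proof.
apply: contra (valP u) => /eqP/msetP uv0; apply/eqP/msetP => x.
by move: (uv0 x); rewrite msetE2 !mset0E => /eqP; rewrite addn_eq0 => /andP[/eqP].
Qed.

Definition wmul (u v : word) : word := Word (wmul_subproof u v).

(* [(u, 1)] is the symbol |_u_|_1, and [(u, 2)] is |_u_|_2 (only if |u| = 2). *)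
Record basis := Basis {
  bpair : word * nat;
  _ : (bpair.2 == 1%N) || (bpair.2 == 2%N) && (wlen bpair.1 == 2%N) }.
HB.instance Definition _ := [isSub for bpair].
(* Opaque, since conversion tests in the free module on [basis] may otherwise
   unfold the comparison of multisets and diverge. *)
Fact basis_eqType : hasDecEq basis.
Proof. exact: (Equality.class (sub_type basis)). Qed.
HB.instance Definition _ := basis_eqType.
HB.instance Definition _ := [Choice of basis by <:].

Definition bword (p : basis) : word := (bpair p).1.
Definition bindex (p : basis) : nat := (bpair p).2.

Definition mkindex (u : word) (m : nat) : nat :=
  if (m == 2%N) && (wlen u == 2%N) then 2%N else 1%N.

Lemma mkbasis_subproof (u : word) (m : nat) :
  let p := (u, mkindex u m) in
  (p.2 == 1%N) || (p.2 == 2%N) && (wlen p.1 == 2%N).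
Proof. by rewrite /mkindex /=; case: ifP => // /andP[]. Qed.

(* |_u_|_m when this symbol exists, and |_u_|_1 otherwise. *)
Definition mkbasis (u : word) (m : nat) : basis :=
  Basis (mkbasis_subproof u m).

End Words.

Arguments word {d} X.
Arguments basis {d} X.

Record comm_dialgebra (k : fieldType) (D : lmodType k)
    (vd dv : D -> D -> D) : Prop := {
  vd_linearl : forall c a b e, vd (c *: a + b) e = c *: vd a e + vd b e;
  vd_linearr : forall c a b e, vd e (c *: a + b) = c *: vd e a + vd e b;
  dv_linearl : forall c a b e, dv (c *: a + b) e = c *: dv a e + dv b e;
  dv_linearr : forall c a b e, dv e (c *: a + b) = c *: dv e a + dv e b;
  vd_assoc : associative vd;
  dv_assoc : associative dv;
  vd_comm : commutative vd;
  dv_comm : commutative dv;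
  dv_vd : forall a b c, dv a (vd b c) = dv a (dv b c);
  vd_dv : forall a b c, vd (dv a b) c = vd (vd a b) c;
  vd_dvA : forall a b c, vd a (dv b c) = dv (vd a b) c
}.

Definition dideal (k : fieldType) (D : lmodType k) (vd dv : D -> D -> D)
    (I : set D) : Prop :=
  [/\ I 0,
      forall (c : k) f g, I f -> I g -> I (c *: f + g),
      forall f g, I f -> I (vd f g) /\ I (vd g f)
    & forall f g, I f -> I (dv f g) /\ I (dv g f)].

Section FreeDialgebra.
Context {d : Order.disp_t} {X : orderType d} {k : fieldType}.

Definition Di := {malg k[basis X]}.

Definition bilin (mul : basis X -> basis X -> basis X) (f g : Di) : Di :=
  \sum_(u <- msupp f) \sum_(v <- msupp g) << f@_u * g@_v *g mul u v >>.

(* On basis elements both products multiply the underlying words, and they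
   differ only when both factors are letters. *)
Definition vdash : Di -> Di -> Di :=
  bilin (fun u v => mkbasis (wmul (bword u) (bword v)) 2).
Definition dashv : Di -> Di -> Di :=
  bilin (fun u v => mkbasis (wmul (bword u) (bword v)) 1).

Definition dword1 (u : word X) : Di := << mkbasis u 1 >>.
Definition gen (x : X) : Di := dword1 (letter x).

Definition ideal (I : set Di) : Prop := dideal vdash dashv I.

Definition Id (S : set Di) : set Di := smallest ideal S.

Section Bilin.
Variable mul : basis X -> basis X -> basis X.

Lemma bilinEw (d1 d2 : {fset basis X}) (f g : Di) :
  (msupp f `<=` d1)%fset -> (msupp g `<=` d2)%fset ->
  bilin mul f g = \sum_(u <- d1) \sum_(v <- d2) << f@_u * g@_v *g mul u v >>.
Proof.
move=> s1 s2; rewrite /bilin (big_fset_incl _ s1) /=; last first.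
  move=> u _ /mcoeff_outdom fu0.
  by rewrite big1 // => v _; rewrite fu0 mul0r monalgU0.
apply: eq_bigr => u _; rewrite (big_fset_incl _ s2) //= => v _.
by move=> /mcoeff_outdom gv0; rewrite gv0 mulr0 monalgU0.
Qed.

Lemma malgUZ (c e : k) (u : basis X) :
  << c * e *g u >> = c *: << e *g u >> :> Di.
Proof. by apply/malgP => v; rewrite mcoeffZ !mcoeffU mulrnAr. Qed.

Lemma bilin_linearl (c : k) (f g h : Di) :
  bilin mul (c *: f + g) h = c *: bilin mul f h + bilin mul g h.
Proof.
pose D := (msupp f `|` msupp g `|` msupp (c *: f + g))%fset.
have sf : (msupp f `<=` D)%fset by rewrite /D -fsetUA fsubsetUl.
have sg : (msupp g `<=` D)%fset by rewrite /D fsetUAC fsubsetUr.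
have s : (msupp (c *: f + g) `<=` D)%fset by rewrite /D fsubsetUr.
have sh := fsubset_refl (msupp h).
rewrite (bilinEw s sh) (bilinEw sf sh) (bilinEw sg sh).
rewrite scaler_sumr -big_split /=; apply: eq_bigr => u _.
rewrite scaler_sumr -big_split /=; apply: eq_bigr => v _.
by rewrite mcoeffD mcoeffZ mulrDl monalgUD -mulrA (malgUZ c).
Qed.

Lemma bilin_linearr (c : k) (f g h : Di) :
  bilin mul h (c *: f + g) = c *: bilin mul h f + bilin mul h g.
Proof.
pose D := (msupp f `|` msupp g `|` msupp (c *: f + g))%fset.
have sf : (msupp f `<=` D)%fset by rewrite /D -fsetUA fsubsetUl.
have sg : (msupp g `<=` D)%fset by rewrite /D fsetUAC fsubsetUr.
have s : (msupp (c *: f + g) `<=` D)%fset by rewrite /D fsubsetUr.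
have sh := fsubset_refl (msupp h).
rewrite (bilinEw sh s) (bilinEw sh sf) (bilinEw sh sg).
rewrite scaler_sumr -big_split /=; apply: eq_bigr => u _.
rewrite scaler_sumr -big_split /=; apply: eq_bigr => v _.
by rewrite mcoeffD mcoeffZ mulrDr monalgUD mulrCA (malgUZ c).
Qed.

Lemma bilinU (u v : basis X) :
  bilin mul << u >> << v >> = << mul u v >>.
Proof.
by rewrite /bilin !msuppU oner_eq0 big_seq_fset1 big_seq_fset1 !mcoeffUU mulr1.
Qed.

End Bilin.

Lemma linear_ext (F G : Di -> Di) :
  (forall c f g, F (c *: f + g) = c *: F f + F g) ->
  (forall c f g, G (c *: f + g) = c *: G f + G g) ->
  (forall u, F << u >> = G << u >>) -> F =1 G.
Proof.
have z (H : Di -> Di) :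
    (forall c a b, H (c *: a + b) = c *: H a + H b) -> H 0 = 0.
  move=> lH; have := lH 1 0 0; rewrite !scale1r addr0 => /esym /eqP.
  by rewrite -subr_eq0 addrK => /eqP.
move=> lF lG FG f; rewrite (monalgE f).
elim: (enum_fset (msupp f)) => [|u s IH]; first by rewrite big_nil !z.
by rewrite big_cons -[f@_u]mulr1 malgUZ lF lG FG IH.
Qed.

Lemma wlen_gt0 (u : word X) : (0 < wlen u)%N.
Proof. by rewrite lt0n size_mset_eq0 (valP u). Qed.

Lemma wlen_wmul (u v : word X) : wlen (wmul u v) = (wlen u + wlen v)%N.
Proof.
pose D := (finsupp (wmset u) `|` finsupp (wmset v)
            `|` finsupp (wmset u `+` wmset v)%mset)%fset.
have E (A : {mset X}) : (finsupp A `<=` D)%fset ->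
    size A = (\sum_(x <- D) A x)%N.
  by move=> sA; rewrite size_mset (big_fset_incl _ sA) // => x _ /fsfun_dflt.
rewrite /wlen !E ?[wmset (wmul u v)]/=.
- by rewrite -big_split /=; apply: eq_bigr => x _; rewrite msetE2.
- by rewrite /D fsetUAC fsubsetUr.
- by rewrite /D -fsetUA fsubsetUl.
- by rewrite /D fsubsetUr.
Qed.

Lemma wmulC (u v : word X) : wmul u v = wmul v u.
Proof. by apply: val_inj; rewrite /= msetDC. Qed.

Lemma wmulA (u v w : word X) : wmul u (wmul v w) = wmul (wmul u v) w.
Proof. by apply: val_inj; rewrite /= msetDA. Qed.

Lemma mkbasis3 (u v w : word X) (m : nat) :
  mkbasis (wmul u (wmul v w)) m = mkbasis (wmul u (wmul v w)) 1.
Proof.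
apply: val_inj; rewrite /= /mkindex !wlen_wmul.
have := wlen_gt0 u; have := wlen_gt0 v; have := wlen_gt0 w.
by case: (wlen u) (wlen v) (wlen w) => [//|[|?]] [//|?] [//|?] _ _ _;
  rewrite ?addnS ?andbF.
Qed.

Lemma Di_comm_dialgebra : comm_dialgebra vdash dashv.
Proof.
pose b m : Di -> Di -> Di :=
  bilin (fun u v => mkbasis (wmul (bword u) (bword v)) m).
have bl m := bilin_linearl (fun u v => mkbasis (wmul (bword u) (bword v)) m).
have br m := bilin_linearr (fun u v => mkbasis (wmul (bword u) (bword v)) m).
rewrite -!/(b _) in bl br.
have bC m : commutative (b m).
  move=> f g; move: f; apply: linear_ext => [c f h|c f h|u].
  - exact: bl.
  - exact: br.
  move: g; apply: linear_ext => [c f h|c f h|v]; [exact: br|exact: bl|].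
  by rewrite /b !bilinU wmulC.
have bA m n m' n' (f g h : Di) : b m f (b n g h) = b m' (b n' f g) h.
  move: f; apply: linear_ext => [c f f'|c f f'|u].
  - by rewrite /b bilin_linearl.
  - by rewrite /b !bilin_linearl.
  move: g; apply: linear_ext => [c f f'|c f f'|v].
  - by rewrite /b bilin_linearl bilin_linearr.
  - by rewrite /b bilin_linearr bilin_linearl.
  move: h; apply: linear_ext => [c f f'|c f f'|w].
  - by rewrite /b !bilin_linearr.
  - by rewrite /b bilin_linearr.
  by rewrite /b !bilinU /bword /= -!wmulA (mkbasis3 _ _ _ m) (mkbasis3 _ _ _ m').
split=> //; try by [exact: bl | exact: br | exact: bC | exact: bA].
- by move=> f g h; rewrite [LHS](bA 1%N 2%N 1%N 1%N) [RHS](bA 1%N 1%N 1%N 1%N).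
- by move=> f g h; rewrite -[LHS](bA 2%N 2%N 2%N 1%N) -[RHS](bA 2%N 2%N 2%N 2%N).
Qed.

End FreeDialgebra.

Arguments Di {d} X k.

Section GroebnerShirshov.
Context {d : Order.disp_t} {X : orderType d} {k : fieldType}.
Local Notation word := (word X).
Local Notation basis := (basis X).
Local Notation Di := (Di X k).

(* The ordering of X is unrelated to [gt]. *)
Record monomial_ordering (gt : rel word) : Prop := {
  gt_irr : irreflexive gt;
  gt_trans : transitive gt;
  gt_total : forall u v, u != v -> gt u v || gt v u;
  gt_wf : well_founded (fun u v => gt v u);
  gt_wmul : forall u v w, gt u v -> gt (wmul u w) (wmul v w)
}.

Variable gt : rel word.

Definition center_gt (p q : basis) : bool :=
  gt (bword p) (bword q)
  || (bword p == bword q) && (bindex q < bindex p)%N.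

(* The largest element of the support; [None] stands for the convention
   that the leading monomial of 0 is 0, smaller than everything. *)
Definition lm (f : Di) : option basis :=
  ohead [seq p <- msupp f | all (fun q => ~~ center_gt q p) (msupp f)].

Definition lw (f : Di) : option word := omap bword (lm f).

Definition lc (f : Di) : k := if lm f is Some p then f@_p else 0.

Definition rest (f : Di) : Di :=
  if lm f is Some p then f - lc f *: << p >> else 0.

Definition ogt (T : Type) (r : rel T) (a b : option T) : bool :=
  match a, b with
  | Some p, Some q => r p q
  | Some _, None => true
  | None, _ => false
  end.

Definition lm_le (f g : Di) : Prop :=
  lm f = lm g \/ ogt center_gt (lm g) (lm f).

Definition monic (f : Di) : Prop := lc f = 1.

Definition strong (f : Di) : bool := (f != 0) && ogt gt (lw f) (lw (rest f)).

(* [normal s b m h] : h is the normal s-polynomial |_sb_|_m. *)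
Inductive normal (s : Di) : {mset X} -> nat -> Di -> Prop :=
| normal_eps p : lm s = Some p -> normal s mset0 (bindex p) s
| normal_vdash u x : lw s = Some u -> wlen u = 1%N ->
    normal s [mset x] 2 (vdash s (gen x))
| normal_dashv (b : word) : strong s ->
    normal s (wmset b) 1 (dashv s (dword1 b)).

Definition normal_poly (S : set Di) (h : Di) : Prop :=
  exists s b m, S s /\ normal s b m h.

Definition Irr (S : set Di) : set basis :=
  [set p | forall h, normal_poly S h -> lm h <> Some p]%classic.

(* The first three constructors involve f alone. In [comp_inter_lcm] an empty
   [a] forces g's word to be a proper divisor of f's, so |f| > 2 and the index
   of the leading monomial of f is 1, as [normal f mset0 1] requires. *)
Inductive composition (f g : Di) : Di -> Prop :=
| comp_mul_vdash x : ~~ strong f -> composition f g (vdash f (gen x))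
| comp_mul_dashv x : ~~ strong f -> composition f g (dashv f (gen x))
| comp_mul_diff u x y : strong f -> lw f = Some u -> (1 < wlen u)%N ->
    mkbasis (letter y) 1 \in msupp f ->
    composition f g (vdash f (gen x) - dashv f (gen x))
| comp_equal : f <> g -> lm f = lm g -> composition f g (f - g)
| comp_incl u v x m h : lw f = Some u -> lw g = Some v ->
    wlen u = 2%N -> wlen v = 1%N ->
    normal g [mset x] m h -> lm f = lm h -> composition f g (f - h)
| comp_inter_eq u x h1 h2 : strong f -> strong g ->
    lw f = Some u -> lw g = Some u -> (3 < wlen u + wlen u)%N ->
    lm f <> lm g ->
    normal f [mset x] 1 h1 -> normal g [mset x] 1 h2 ->
    composition f g (h1 - h2)
| comp_inter_lcm u v (a : {mset X}) (b : word) h1 h2 : strong f -> strong g ->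
    lw f = Some u -> lw g = Some v -> (3 < wlen u + wlen v)%N ->
    lm f <> lm g -> u <> v ->
    (wmset u `|` wmset v = wmset u `+` a)%mset ->
    (wmset u `|` wmset v = wmset v `+` wmset b)%mset ->
    (size (wmset u `|` wmset v)%mset < wlen u + wlen v)%N ->
    normal f a 1 h1 -> normal g (wmset b) 1 h2 ->
    composition f g (h1 - h2).

Definition trivial_mod (S : set Di) (h : Di) : Prop :=
  exists r : seq (k * Di),
    [/\ forall p, p \in r -> normal_poly S p.2,
        forall p, p \in r -> p.1 != 0 -> lm_le p.2 h
      & h = \sum_(p <- r) p.1 *: p.2].

Definition GSbasis (S : set Di) : Prop :=
  (forall s, S s -> monic s) /\
  (forall f g h, S f -> S g -> composition f g h -> trivial_mod S h).

Definition reduced_GSbasis (S : set Di) : Prop :=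
  GSbasis S /\
  (forall s, S s -> forall p, p \in msupp s -> Irr (S `\ s)%classic p).

End GroebnerShirshov.

(* Main.v *)
From mathcomp Require Import all_boot all_order all_algebra.
From mathcomp Require Import finmap multiset monalg.
From mathcomp Require Import zify.
From mathcomp Require Import boolp classical_sets.
Require Import Defs.

(** A reduced basis is unique because it is the kernel of a well-founded relation
    that depends on the ideal alone.

    Call an element of the ideal [I] canonical if it is monic and none of its
    other monomials is the leading monomial of an element of [I]. Every leading
    monomial of [I] belongs to exactly one canonical element: existence is
    reduction to normal form, which ends because the ordering is well-founded
    ([canonical_exists]), and the difference of two such elements would be an
    element of [I] none of whose monomials can lead ([canonical_inj]). Say that
    a canonical [s] reduces another canonical [f] if the leading monomial of [f]
    is that of a normal [s]-polynomial; the leading monomial of [s] is then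
    smaller ([reduces_wf]). A set [S] is a reduced Groebner-Shirshov basis of [I]
    exactly if it is a kernel of this relation: a canonical [f] is in [S] if and
    only if no element of [S] reduces it ([kernel_reduced], [reduced_kernel]). A
    well-founded relation has exactly one kernel ([kernel_exists],
    [kernel_unique]), by recursion and induction.

    From a kernel to a basis: each leading monomial of [I] is one of a normal
    [S]-polynomial, by definition of a kernel, so that division shows every
    element of [I] to be trivial modulo [S]. Compositions are elements of [I].

    From a reduced basis [T] to a kernel: this needs that a nonzero element of
    [Id T] has the same leading monomial as some normal [T]-polynomial ([Id_lm]).
    The normal polynomials span [Id T] ([span_mulb]): their products with letters
    are normal up to compositions, which are trivial. Two normal polynomials with
    the same leading monomial differ by normal polynomials with smaller leading
    words ([NP_diff]). Hence, in a linear combination of normal polynomials, those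
    with the largest leading monomial can be merged into one, and what remains of
    them is either a single leading term or a combination of smaller ones.

    In the proof of [NP_diff], let [s1] and [s2] be the elements of [T] that are
    multiplied. If their leading words are equal, a composition compares them
    ([nspan_same_word]). Otherwise, neither word divides the other as [T] is
    reduced, and everything is a multiple of the difference at the lcm of the
    words ([nspan_distinct_words]). If the words [u] of [s1] and [v] of [s2] have
    a common letter, that difference is a composition. If they are coprime, it is
    the product of [s1] with [v] minus the product of [s2] with [u]; replacing
    [v] by [s2] and [u] by [s1] makes it vanish by commutativity, at the price of
    products with the smaller monomials of [s1] and [s2] ([nspan_swap]). *)

Set Implicit Arguments.
Unset Strict Implicit.
Unset Printing Implicit Defensive.

Import GRing.Theory.
Local Open Scope mset_scope.
Local Open Scope ring_scope.

(** * Words and basis symbols *)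

Section Words.
Context {d : Order.disp_t} {X : orderType d}.
Implicit Types (u v w b : word X) (p q : basis X) (x : X).

Lemma wlen_letter x : wlen (letter x) = 1%N.
Proof. by rewrite /wlen /= enum_msetn. Qed.

Lemma word_ind (P : word X -> Prop) :
  (forall x, P (letter x)) -> (forall x v, P v -> P (wmul (letter x) v)) ->
  forall u, P u.
Proof.
move=> Pl Pm u; have [n] := ubnP (wlen u); elim: n u => // n IH u lt.
case: (mset_0Vmem (wmset u)) => [u0|[x xu]]; first by have /eqP := valP u.
have E : wmset u = [mset x] `+` (wmset u `\ x) by rewrite msetB1K.
have [v0|vn0] := eqVneq (wmset u `\ x) mset0.
  by rewrite (_ : u = letter x) //; apply: val_inj; rewrite /= E v0 msetD0.
have Eu : u = wmul (letter x) (Word vn0) by apply: val_inj.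
have Ew : wlen u = (wlen (Word vn0)).+1 by rewrite [in LHS]Eu wlen_wmul wlen_letter.
by rewrite Eu; apply/Pm/IH; rewrite Ew in lt.
Qed.

Lemma wlen1P u : wlen u = 1%N -> exists x, u = letter x.
Proof.
elim/word_ind: u => [x _|x v _]; first by exists x.
by rewrite wlen_wmul wlen_letter; have := wlen_gt0 v; case: (wlen v).
Qed.

Lemma wmulI u v w : wmul u v = wmul u w -> v = w.
Proof. by move=> /(congr1 val) /= /(can_inj (msetDKB _)); exact: val_inj. Qed.

Lemma bword_mk u m : bword (mkbasis u m) = u.
Proof. by []. Qed.

Lemma bindex_range p : bindex p = 1%N \/ bindex p = 2%N /\ wlen (bword p) = 2%N.
Proof.
have := valP p; rewrite /bindex /bword.
by case/orP => [/eqP ->|/andP[/eqP -> /eqP ->]]; [left|right].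
Qed.

Lemma basis_eq p q : bword p = bword q -> bindex p = bindex q -> p = q.
Proof.
rewrite /bword /bindex => E1 E2; apply: val_inj => /=.
by case: (bpair p) (bpair q) E1 E2 => [? ?] [? ?] /= -> ->.
Qed.

Lemma bindex1 p : wlen (bword p) != 2%N -> bindex p = 1%N.
Proof. by case: (bindex_range p) => // -[_ ->]. Qed.

Lemma bindex_mk2 u : wlen u = 2%N -> bindex (mkbasis u 2) = 2%N.
Proof. by rewrite /bindex /= /mkindex => ->. Qed.

Lemma mkbasis21 u : wlen u != 2%N -> mkbasis u 2 = mkbasis u 1.
Proof.
by move=> /negPf l2; apply: basis_eq => //; rewrite /bindex /= /mkindex l2.
Qed.

Lemma size_msetD (A B : {mset X}) : size (A `+` B) = (size A + size B)%N.
Proof.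
rewrite -size_cat; apply: perm_size; apply/allP => x _.
by rewrite /= count_cat !count_mem_mset msetE2.
Qed.

(** Words whose lcm is as long as their product are coprime. *)
Lemma lcm_coprime u v :
  (wlen u + wlen v <= size (wmset u `|` wmset v))%N ->
  wmset u `|` wmset v = wmset u `+` wmset v.
Proof.
have Ev : wmset v = (wmset v `\` wmset u) `+` (wmset v `&` wmset u).
  apply/msetP => y; rewrite !msetE2 addnC.
  by case: (leqP (wmset v y)) => h;
    [move: h; rewrite -subn_eq0 => /eqP ->; rewrite addn0|rewrite subnKC // ltnW].
have := size_msetD (wmset v `\` wmset u) (wmset v `&` wmset u).
rewrite -Ev (msetUE _ _ mset0) size_msetD leq_add2l /wlen => ->; rewrite -[leqRHS]addn0.
rewrite leq_add2l leqn0 size_mset_eq0 => /eqP vu0.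
by rewrite [in RHS]Ev vu0 msetD0.
Qed.

End Words.

(** * Monomial orderings *)

Section Ordering.
Context {d : Order.disp_t} {X : orderType d} (gt : rel (word X)).
Context (mo : monomial_ordering gt).
Implicit Types (u v w : word X) (p q : basis X).
Local Notation cgt := (center_gt gt).

(** A word has infinitely many proper multiples, so a monomial ordering cannot let
    them decrease. *)
Lemma wmul_gt u w : gt (wmul u w) u.
Proof.
have ne : wmul u w != u.
  apply/eqP => /(congr1 wlen); rewrite wlen_wmul => /eqP.
  by rewrite -[eqbRHS]addn0 eqn_add2l; have := wlen_gt0 w; case: (wlen w).
case/orP: (gt_total mo ne) => // ug.
exfalso; move: u ug {ne}; apply: (well_founded_ind (gt_wf mo)) => u IH ug.
by apply: (IH _ ug); apply: gt_wmul.
Qed.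

Lemma cgt_irr : irreflexive cgt.
Proof. by move=> p; rewrite /center_gt (gt_irr mo) ltnn andbF. Qed.

Lemma cgt_trans : transitive cgt.
Proof.
move=> q p r /orP[g1|/andP[/eqP e1 l1]] /orP[g2|/andP[/eqP e2 l2]].
- by rewrite /center_gt (gt_trans mo g1 g2).
- by rewrite /center_gt -e2 g1.
- by rewrite /center_gt e1 g2.
- by rewrite /center_gt e1 e2 eqxx (ltn_trans l2 l1) orbT.
Qed.

Lemma cgt_total p q : p != q -> cgt p q || cgt q p.
Proof.
rewrite /center_gt => ne; have [e|nw] := eqVneq (bword p) (bword q); last first.
  by case/orP: (gt_total mo nw) => ->; rewrite ?orbT.
rewrite -e (gt_irr mo) /=.
case: (ltngtP (bindex p) (bindex q)) => // ei.
by case/eqP: ne; exact: basis_eq.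
Qed.

(** Only below a symbol of index 2 is there a symbol with the same word. *)
Lemma cgt_index1 p q : bindex p = 1%N -> cgt p q -> gt (bword p) (bword q).
Proof.
move=> p1 /orP[//|/andP[_]]; rewrite p1.
by case: (bindex_range q) => [->|[->]].
Qed.

Lemma cgt_wf : well_founded (fun p q => cgt q p).
Proof.
move=> p; have [w ew] : exists w, bword p = w by exists (bword p).
move: p ew; elim/(well_founded_ind (gt_wf mo)): w => w IHw p ew.
have low q : bword q = w -> bindex q = 1%N -> Acc (fun p q => cgt q p) q.
  move=> eq q1; constructor => r /(cgt_index1 q1) g.
  by apply: (IHw (bword r)) => //; rewrite -eq.
case: (bindex_range p) => [|[p2 _]]; first exact: low.
constructor => q /orP[g|/andP[/eqP e l]].
  by apply: (IHw (bword q)) => //; rewrite -ew.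
apply: low; first by rewrite -e.
by case: (bindex_range q) => // -[q2]; rewrite p2 q2 in l.
Qed.

Lemma cgt_word p q : gt (bword p) (bword q) -> cgt p q.
Proof. by rewrite /center_gt => ->. Qed.

Lemma cgt_wordW p q : cgt p q -> gt (bword p) (bword q) \/ bword p = bword q.
Proof. by case/orP => [|/andP[/eqP]]; [left|right]. Qed.

Lemma cgt_asym p q : cgt p q -> cgt q p = false.
Proof. by move=> pq; apply/negP => /(cgt_trans pq); rewrite cgt_irr. Qed.

End Ordering.

(** * Subspaces and linear maps *)

Section Linear.
Context {d : Order.disp_t} {X : orderType d} {k : fieldType}.
Local Notation Di := (Di X k).
Implicit Types (f g h : Di) (p q : basis X) (u v b : word X).

Definition subspace (V : Di -> Prop) : Prop :=
  V 0 /\ forall (c : k) f g, V f -> V g -> V (c *: f + g).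

Definition linmap (F : Di -> Di) : Prop :=
  forall (c : k) f g, F (c *: f + g) = c *: F f + F g.

Section Subspace.
Context {V : Di -> Prop} (sV : subspace V).

Lemma sub0 : V 0. Proof. by case: sV. Qed.

Lemma subZ (c : k) f : V f -> V (c *: f).
Proof. by case: sV => V0 VD Vf; rewrite -[c *: f]addr0; apply: VD. Qed.

Lemma subD f g : V f -> V g -> V (f + g).
Proof. by case: sV => V0 VD Vf Vg; rewrite -[f]scale1r; apply: VD. Qed.

Lemma subB f g : V f -> V g -> V (f - g).
Proof. by move=> Vf Vg; rewrite -scaleN1r; apply/subD/subZ. Qed.

Lemma sub_sum (I : eqType) (r : seq I) (F : I -> Di) :
  (forall i, i \in r -> V (F i)) -> V (\sum_(i <- r) F i).
Proof.
elim: r => [_|i r IH H]; first by rewrite big_nil; exact: sub0.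
rewrite big_cons; apply: subD; first by apply: H; rewrite inE eqxx.
by apply: IH => j jr; apply: H; rewrite inE jr orbT.
Qed.

End Subspace.

Lemma linmap0 F : linmap F -> F 0 = 0.
Proof.
move=> lF; have := lF 1 0 0; rewrite !scale1r addr0 => /esym /eqP.
by rewrite -subr_eq0 addrK => /eqP.
Qed.

Lemma linmapB F f g : linmap F -> F (f - g) = F f - F g.
Proof. by move=> lF; rewrite addrC -scaleN1r lF scaleN1r addrC. Qed.

Lemma subspace_preim F V : linmap F -> subspace V -> subspace (fun f => V (F f)).
Proof.
move=> lF sV; split=> [|c f g Vf Vg]; first by rewrite linmap0 //; exact: sub0.
by rewrite lF; apply/subD/Vg/subZ.
Qed.

(** Used with [V] the preimage of a subspace under a linear map, this reduces a
    claim on the image of [f] to the monomials of [f]. *)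
Lemma subspace_basis V f :
  subspace V -> (forall q, q \in msupp f -> V << q >>) -> V f.
Proof.
move=> sV H; rewrite (monalgE f); apply: sub_sum => // q qf.
by rewrite -[f@_q]mulr1 malgUZ; apply: subZ => //; apply: H.
Qed.

Lemma supp_subspace (P : basis X -> Prop) :
  subspace (fun f => forall q, q \in msupp f -> P q).
Proof.
split=> [q|c f g Hf Hg q]; first by rewrite msupp0.
move=> /(fsubsetP (msuppD_le _ _)); rewrite inE => /orP[qf|]; last exact: Hg.
exact/Hf/(fsubsetP (msuppZ_le c f)).
Qed.

Inductive span (P : Di -> Prop) : Di -> Prop :=
| span0 : span P 0
| spanS c h f : P h -> span P f -> span P (c *: h + f).

Lemma span_subspace P : subspace (span P).
Proof.
split=> [|c f g Pf Pg]; first exact: span0.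
elim: Pf => [|a h {}f Ph _ IH]; first by rewrite scaler0 add0r.
by rewrite scalerDr scalerA -addrA; apply: spanS.
Qed.

Lemma span_gen (P : Di -> Prop) h : P h -> span P h.
Proof. by move=> Ph; rewrite -[h]scale1r -[1 *: h]addr0; apply/spanS/span0. Qed.

Lemma span_sub (P V : Di -> Prop) f :
  subspace V -> (forall h, P h -> V h) -> span P f -> V f.
Proof.
move=> sV PV; elim=> [|c h {}f Ph _ Vf]; first exact: sub0.
by apply/subD/Vf/subZ/PV.
Qed.

(** [mulb 2] is [vdash] and [mulb 1] is [dashv], by conversion: one family allows
    one proof for both. *)
Definition mulb (m : nat) : Di -> Di -> Di :=
  bilin (fun p q => mkbasis (wmul (bword p) (bword q)) m).

Lemma mulb_linl m g : linmap (mulb m ^~ g).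
Proof. by move=> c f h; exact: bilin_linearl. Qed.

Lemma mulb_linr m f : linmap (mulb m f).
Proof. by move=> c g h; exact: bilin_linearr. Qed.

Lemma mulbU m p q : mulb m << p >> << q >> = << mkbasis (wmul (bword p) (bword q)) m >>.
Proof. exact: bilinU. Qed.

Lemma eq_linmap F G f : linmap F -> linmap G ->
  (forall q, q \in msupp f -> F << q >> = G << q >>) -> F f = G f.
Proof.
move=> lF lG FG; apply: (@subspace_basis (fun f => F f = G f)) FG.
by split=> [|c h g e1 e2]; rewrite ?linmap0 // lF lG e1 e2.
Qed.

Lemma mulbC m f g : mulb m f g = mulb m g f.
Proof.
apply: (@eq_linmap (mulb m ^~ g) (mulb m g)) => [||p _].
- exact: mulb_linl.
- exact: mulb_linr.
apply: (@eq_linmap (mulb m _) (mulb m ^~ _)) => [||q _]; last by rewrite !mulbU wmulC.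
- exact: mulb_linr.
- exact: mulb_linl.
Qed.

(** The index of a factor is lost in a product. *)
Lemma mulb_word m f q : mulb m f << q >> = mulb m f (dword1 (bword q)).
Proof.
apply: (@eq_linmap (mulb m ^~ _) (mulb m ^~ _)) => [||p _]; try exact: mulb_linl.
by rewrite /dword1 !mulbU.
Qed.

(** A product of three factors has a word of length at least three, hence index 1
    whatever the two products were. *)
Lemma mulbA m n f u v :
  mulb m (mulb n f (dword1 u)) (dword1 v) = mulb 1 f (dword1 (wmul u v)).
Proof.
apply: (@eq_linmap (fun f => mulb m (mulb n f _) _) (mulb 1 ^~ _)) => [c g h|c g h|p _].
- by rewrite !mulb_linl.
- by rewrite mulb_linl.
by rewrite /dword1 !mulbU !bword_mk -wmulA mkbasis3.
Qed.

(** The products differ only on a pair of letters, whose word has length two. *)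
Lemma mulb21 f b :
  (forall q, q \in msupp f -> (2 < wlen (bword q) + wlen b)%N) ->
  mulb 2 f (dword1 b) = mulb 1 f (dword1 b).
Proof.
move=> H; apply: (@eq_linmap (mulb 2 ^~ _) (mulb 1 ^~ _)) => [||p /H l].
- exact: mulb_linl.
- exact: mulb_linl.
rewrite /dword1 !mulbU bword_mk mkbasis21 // wlen_wmul.
by rewrite neq_ltn l orbT.
Qed.

End Linear.

(** * Leading monomials *)

Section Leading.
Context {d : Order.disp_t} {X : orderType d} {k : fieldType}.
Context (gt : rel (word X)) (mo : monomial_ordering gt).
Local Notation Di := (Di X k).
Local Notation cgt := (center_gt gt).
Implicit Types (f g h r s : Di) (p q : basis X) (u v w b : word X) (x : X).

Definition below p f : Prop := forall q, q \in msupp f -> cgt p q.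

Definition wbelow u f : Prop := forall q, q \in msupp f -> gt u (bword q).

(** Monic with leading monomial [p], in a form that is stable under linear maps;
    see [lead_lm], [lead_monic] and [monic_lead]. *)
Definition lead f p : Prop := below p (f - << p >>).

(** The strong version of [lead]: the other words are smaller, not only the
    symbols. *)
Definition slead f p : Prop := wbelow (bword p) (f - << p >>).

Lemma below_subspace p : subspace (below p).
Proof. exact: supp_subspace. Qed.

Lemma wbelow_subspace u : subspace (wbelow u).
Proof. exact: (supp_subspace (fun q => gt u (bword q))). Qed.

Lemma wbelow_below p f : wbelow (bword p) f -> below p f.
Proof. by move=> H q /H; exact: cgt_word. Qed.

Lemma below_wbelow p f : bindex p = 1%N -> below p f -> wbelow (bword p) f.
Proof. by move=> p1 H q /H; exact: cgt_index1. Qed.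

Lemma slead_lead f p : slead f p -> lead f p.
Proof. exact: wbelow_below. Qed.

Lemma lead_slead f p : bindex p = 1%N -> lead f p -> slead f p.
Proof. exact: below_wbelow. Qed.

Lemma below_trans p q f : cgt p q -> below q f -> below p f.
Proof. by move=> pq H r /H; exact: cgt_trans. Qed.

Lemma mcoeff_below p f : below p f -> f@_p = 0.
Proof. by move=> H; apply: mcoeff_outdom; apply/negP => /H; rewrite cgt_irr. Qed.

Lemma lmE f p : p \in msupp f -> (forall q, q \in msupp f -> q != p -> cgt p q) ->
  lm gt f = Some p.
Proof.
move=> pf H; rewrite /lm.
set P := fun p0 => all _ _.
have EP q : q \in msupp f -> P q = (q == p).
  move=> qf; apply/allP/eqP => [/(_ p pf) npq|-> r rf].
    by apply/eqP; apply: contraNT npq; exact: H.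
  have [-> |ne] := eqVneq r p; first by rewrite cgt_irr.
  by rewrite (cgt_asym mo (H _ rf ne)).
rewrite (eq_in_filter EP) filter_pred1_uniq //; exact: fset_uniq.
Qed.

Lemma lm_exists f : f != 0 ->
  exists2 p, p \in msupp f & forall q, q \in msupp f -> q != p -> cgt p q.
Proof.
have [f0|[p0 p0f] _] := fset_0Vmem (msupp f).
  by case/eqP; apply/malgP => q; rewrite mcoeff0 mcoeff_outdom // f0.
have [p ps H] : exists2 p, p \in enum_fset (msupp f) &
    forall q, q \in enum_fset (msupp f) -> q != p -> cgt p q.
  have {p0f} : p0 \in enum_fset (msupp f) by [].
  elim: (enum_fset (msupp f)) p0 => // a s IH _ _.
  case: s IH => [_|b s IH].
    by exists a; rewrite ?mem_seq1 // => q; rewrite mem_seq1 => ->.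
  have [p ps H] := IH b (mem_head _ _).
  have [->|ne] := eqVneq a p.
    exists p; first exact: mem_head.
    by move=> q; rewrite in_cons => /orP[->|/H].
  case/orP: (cgt_total mo ne) => c.
    exists a; first exact: mem_head.
    move=> q; rewrite in_cons => /orP[->//|qs _].
    by have [->|/(H _ qs)] := eqVneq q p; last exact: (cgt_trans mo c).
  exists p; first by rewrite in_cons ps orbT.
  by move=> q; rewrite in_cons => /orP[/eqP ->|/H].
by exists p.
Qed.

Lemma lmP f p : lm gt f = Some p ->
  p \in msupp f /\ forall q, q \in msupp f -> q != p -> cgt p q.
Proof.
have [->|/lm_exists [q qf H]] := eqVneq f 0; first by rewrite /lm msupp0.
by rewrite (lmE qf H) => -[<-].
Qed.

Lemma lm_neq0 f : f != 0 -> exists p, lm gt f = Some p.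
Proof. by case/lm_exists => p pf H; exists p; exact: lmE. Qed.

Lemma lm_dominant (c : k) p r : c != 0 -> below p r ->
  lm gt (c *: << p >> + r) = Some p.
Proof.
move=> c0 H; have pr := mcoeff_below H; apply: lmE => [|q].
  by rewrite -mcoeff_neq0 mcoeffD mcoeffZ mcoeffUU mulr1 pr addr0.
rewrite -mcoeff_neq0 mcoeffD mcoeffZ mcoeffU => nz ne; apply: H.
by move: nz; rewrite [p == q]eq_sym (negPf ne) mulr0n mulr0 add0r mcoeff_neq0.
Qed.

Lemma below_rest f p : lm gt f = Some p ->
  f@_p != 0 /\ below p (f - f@_p *: << p >>).
Proof.
case/lmP => pf H; split=> [|q]; first by rewrite mcoeff_neq0.
rewrite -mcoeff_neq0 mcoeffB mcoeffZ mcoeffU.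
have [<-|ne] := eqVneq p q; first by rewrite mulr1 subrr eqxx.
by rewrite mulr0n mulr0 subr0 mcoeff_neq0 => /H; apply; rewrite eq_sym.
Qed.

Lemma lead_lm f p : lead f p -> lm gt f = Some p.
Proof.
move=> H; rewrite -(subrK << p >> f) addrC -[<< p >>]scale1r.
by apply: lm_dominant; rewrite ?oner_eq0 // scale1r.
Qed.

Lemma lead_coef1 f p : lead f p -> f@_p = 1.
Proof.
by move/mcoeff_below/eqP; rewrite mcoeffB mcoeffUU subr_eq0 => /eqP.
Qed.

Lemma lead_monic f p : lead f p -> monic gt f.
Proof. by move=> H; rewrite /monic /lc (lead_lm H) (lead_coef1 H). Qed.

Lemma monic_lead f : monic gt f -> exists p, lead f p.
Proof.
rewrite /monic /lc; case E: (lm gt f) => [p|] c1; last first.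
  by move/eqP: c1; rewrite eq_sym oner_eq0.
by exists p; have [_] := below_rest E; rewrite c1 scale1r.
Qed.

Lemma lead_neq0 f p : lead f p -> f != 0.
Proof.
by move/lead_coef1 => H; apply/eqP => f0; move: H; rewrite f0 mcoeff0 => /eqP;
  rewrite eq_sym oner_eq0.
Qed.

Lemma lead_inj f p q : lead f p -> lead f q -> p = q.
Proof. by move=> /lead_lm E /lead_lm; rewrite E => -[]. Qed.

Lemma lead_mem f p : lead f p -> p \in msupp f.
Proof. by move/lead_lm/lmP => []. Qed.

Lemma lead_supp f p q : lead f p -> q \in msupp f -> q != p -> cgt p q.
Proof. by move/lead_lm/lmP => [_]; apply. Qed.

Lemma slead_strong f p : slead f p -> strong gt f.
Proof.
move=> sf; have lf := slead_lead sf.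
rewrite /strong (lead_neq0 lf) /lw /rest /lc (lead_lm lf) (lead_coef1 lf) scale1r /=.
by case E: (lm gt (f - << p >>)) => [q|//] /=; apply: sf; case: (lmP E).
Qed.

Lemma strong_slead f p : lead f p -> strong gt f -> slead f p.
Proof.
move=> lf; rewrite /strong (lead_neq0 lf) /lw /rest /lc (lead_lm lf) (lead_coef1 lf).
rewrite scale1r => + q qf.
have [p' E] : exists p', lm gt (f - << p >>) = Some p'.
  by apply: lm_neq0; apply: contraTneq qf => ->; rewrite msupp0.
rewrite E /= => g; have [->//|ne] := eqVneq q p'.
case/cgt_wordW: ((lmP E).2 _ qf ne) => [|<-//].
exact: gt_trans g.
Qed.

Lemma slead_diff f g p : slead f p -> slead g p -> wbelow (bword p) (f - g).
Proof.
move=> sf sg; have := subB (wbelow_subspace (bword p)) sf sg.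
by rewrite opprB addrA subrK.
Qed.

(** Bounds on words survive multiplication, unlike bounds on symbols: the two
    symbols of a word have the same products. This is why [slead] is needed in
    [slead_mulb]. *)
Lemma wbelow_mulb m u b f : wbelow u f -> wbelow (wmul u b) (mulb m f (dword1 b)).
Proof.
move=> H; apply: (@subspace_basis _ _ _ (fun f => wbelow _ (mulb m f (dword1 b))) f).
  by apply: subspace_preim (wbelow_subspace _); exact: mulb_linl.
move=> q /H uq r; rewrite /dword1 mulbU msuppU oner_eq0 inE => /eqP ->.
by rewrite !bword_mk; exact: gt_wmul.
Qed.

Lemma slead_mulb m f p b : slead f p ->
  slead (mulb m f (dword1 b)) (mkbasis (wmul (bword p) b) m).
Proof.
move=> sf; rewrite /slead bword_mk; have := wbelow_mulb (m := m) (b := b) sf.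
by rewrite (linmapB _ _ (mulb_linl m _)) [in X in _ - X]/dword1 mulbU bword_mk.
Qed.

End Leading.

(** * Normal polynomials *)

Section Normal.
Context {d : Order.disp_t} {X : orderType d} {k : fieldType}.
Context (gt : rel (word X)) (mo : monomial_ordering gt).
Local Notation Di := (Di X k).
Local Notation cgt := (center_gt gt).
Implicit Types (f g h r s : Di) (p q : basis X) (u v w b : word X) (x : X).
Implicit Types (B : {mset X}) (m n : nat) (S : set Di).

(** The index [m] that a normal polynomial with cofactor [b] may have, when the
    leading monomial of the multiplied element is [p]. *)
Definition normal_index p b m : Prop :=
  m = 1%N \/ [/\ m = 2%N, wlen (bword p) = 1%N & wlen b = 1%N].

Lemma bindex_normal p b m :
  normal_index p b m -> bindex (mkbasis (wmul (bword p) b) m) = m.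
Proof. by case=> [->|[-> l1 l2]] //; rewrite bindex_mk2 // wlen_wmul l1 l2. Qed.

Lemma normal_self s p : lead gt s p -> normal gt s mset0 (bindex p) s.
Proof. by move=> ls; apply/normal_eps/(lead_lm mo ls). Qed.

Lemma normal_mulb s p b m : slead gt s p -> normal_index p b m ->
  normal gt s (wmset b) m (mulb m s (dword1 b)).
Proof.
move=> ss [->|[-> l1 /wlen1P [x ->]]]; first exact/normal_dashv/(slead_strong mo ss).
apply: (@normal_vdash _ _ _ _ _ (bword p)) => //.
by rewrite /lw (lead_lm mo (slead_lead ss)).
Qed.

(** All normal [s]-polynomials other than [s] are products of a strong [s], since a
    leading monomial that is a letter forces [s] to be strong. *)
Lemma normal_inv s p B m h : lead gt s p -> normal gt s B m h ->
  h = s \/ exists n b,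
    [/\ slead gt s p, normal_index p b n & h = mulb n s (dword1 b)].
Proof.
move=> ls; case=> [q _|u x|b st]; first by left.
  rewrite /lw (lead_lm mo ls) => -[<-] l1; right; exists 2%N, (letter x); split=> //.
    by apply: lead_slead ls; apply: bindex1; rewrite l1.
  by right; split=> //; exact: wlen_letter.
by right; exists 1%N, b; split=> //; [exact: (strong_slead mo)|left].
Qed.

Lemma normal_lead s p B m h : lead gt s p -> normal gt s B m h ->
  exists q, lead gt h q /\ (h = s \/ cgt q p).
Proof.
move=> ls /(normal_inv ls) [->|[n [b [ss _ ->]]]]; first by exists p; split=> //; left.
exists (mkbasis (wmul (bword p) b) n); split; first exact/slead_lead/slead_mulb.
by right; apply: cgt_word; rewrite bword_mk; exact: wmul_gt.
Qed.

Lemma normal_poly_lead S h : (forall s, S s -> monic gt s) ->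
  normal_poly gt S h -> exists p, lead gt h p.
Proof.
move=> mS [s [B [m [/mS /(monic_lead mo) [p ls]]]]] /(normal_lead ls) [q [lq _]].
by exists q.
Qed.

Lemma ideal_subspace (I : set Di) : ideal I -> subspace I.
Proof. by case. Qed.

Lemma ideal_mulb (I : set Di) m f g : ideal I -> m = 1%N \/ m = 2%N ->
  I f -> I (mulb m f g).
Proof. by case=> _ _ Hv Hd [->|->] If; [case: (Hd f g If)|case: (Hv f g If)]. Qed.

Lemma normal_ideal (I : set Di) s p B m h : ideal I -> I s -> lead gt s p ->
  normal gt s B m h -> I h.
Proof.
move=> iI Is ls /(normal_inv ls) [->//|[n [b [_ + ->]]]].
by case=> [->|[-> _ _]]; apply: ideal_mulb => //; [left|right].
Qed.

(** A normal [s]-polynomial is determined by its leading monomial: that gives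
    the cofactor of the leading word of [s] and the index, which tells which of
    the two products is used. *)
Lemma normal_lead_inj s p q B1 B2 m1 m2 h1 h2 : lead gt s p ->
  normal gt s B1 m1 h1 -> normal gt s B2 m2 h2 ->
  lead gt h1 q -> lead gt h2 q -> h1 = h2.
Proof.
move=> ls nh1 nh2 lh1 lh2.
have [q1 [lq1 d1]] := normal_lead ls nh1; have [q2 [lq2 d2]] := normal_lead ls nh2.
rewrite (lead_inj mo lq1 lh1) in d1; rewrite (lead_inj mo lq2 lh2) in d2.
case: (normal_inv ls nh1) => [e1|[n1 [b1 [ss1 ok1 e1]]]].
  case: d2 => [->//|]; rewrite e1 in lh1.
  by rewrite (lead_inj mo lh1 ls) cgt_irr.
case: (normal_inv ls nh2) => [e2|[n2 [b2 [ss2 ok2 e2]]]].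
  case: d1 => [->//|]; rewrite e2 in lh2.
  by rewrite (lead_inj mo lh2 ls) cgt_irr.
have ep1 := slead_lead (slead_mulb mo (m := n1) (b := b1) ss1).
have ep2 := slead_lead (slead_mulb mo (m := n2) (b := b2) ss2).
rewrite -e1 in ep1; rewrite -e2 in ep2.
have := lead_inj mo ep1 lh1; rewrite -(lead_inj mo ep2 lh2) => E.
have /wmulI eb := congr1 bword E.
have := congr1 bindex E; rewrite !bindex_normal // => en.
by rewrite e1 e2 eb en.
Qed.

End Normal.

(** * Leading monomials of the ideal of a reduced basis *)

Section Diamond.
Context {d : Order.disp_t} {X : orderType d} {k : fieldType}.
Context (gt : rel (word X)) (mo : monomial_ordering gt).
Local Notation Di := (Di X k).
Local Notation cgt := (center_gt gt).
Implicit Types (f g h r s : Di) (p q : basis X) (u v w b : word X) (x : X).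
Implicit Types (m n : nat).

Context (T : set Di) (redT : reduced_GSbasis gt T).
Local Notation NP := (normal_poly gt T).

Lemma reduced_lead s : T s -> exists p, lead gt s p.
Proof. by case: redT => -[mT _] _ /mT; exact: monic_lead. Qed.

Lemma composition_trivial f g h : T f -> T g -> composition gt f g h -> trivial_mod gt T h.
Proof. by case: redT => -[_ cT] _; exact: cT. Qed.

Lemma reduced_irr s s' p q B m h : T s -> T s' -> lead gt s p ->
  normal gt s' B m h -> lead gt h q -> p = q -> s' = s.
Proof.
case: redT => _ H Ts Ts' ls nh lh epq; apply: contrapT => ne.
apply: (H s Ts p (lead_mem mo ls) h) _; last by rewrite epq; exact: lead_lm lh.
by exists s', B, m.
Qed.

Lemma NP_lead h : NP h -> exists p, lead gt h p.
Proof. by apply: normal_poly_lead => // s; case: redT => -[mT _] _; exact: mT. Qed.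

Lemma NP_self s : T s -> NP s.
Proof.
by move=> Ts; have [p ls] := reduced_lead Ts; exists s, mset0, (bindex p); split=> //;
  exact: normal_self.
Qed.

Lemma NP_mulb s p b m : T s -> slead gt s p -> normal_index p b m ->
  NP (mulb m s (dword1 b)).
Proof. by move=> Ts ss ok; exists s, (wmset b), m; split=> //; exact: normal_mulb ok. Qed.

(** What may be neglected at the word [v]. Bounding words instead of symbols makes
    it stable under products ([nspan_dashv]). *)
Definition nspan v : Di -> Prop :=
  span (fun h => NP h /\ exists2 p, lead gt h p & gt v (bword p)).

Lemma nspan_subspace v : subspace (nspan v).
Proof. exact: span_subspace. Qed.

Lemma trivial_span h : trivial_mod gt T h -> span NP h.
Proof.
case=> r [Hn _ ->]; apply: (sub_sum (span_subspace _)) => c /Hn.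
by move=> Nc; apply: (subZ (span_subspace _)); exact: span_gen.
Qed.

Lemma trivial_nspan v h : trivial_mod gt T h -> wbelow gt v h -> nspan v h.
Proof.
case=> r [Hn Hl eh] H; rewrite eh; apply: (sub_sum (nspan_subspace v)) => c cr.
have [->|c0] := eqVneq c.1 0; first by rewrite scale0r; exact: span0.
apply: (subZ (nspan_subspace v)); apply: span_gen; split; first exact: Hn.
have [p lp] := NP_lead (Hn _ cr); exists p => //.
have [|] := Hl _ cr c0; rewrite (lead_lm mo lp).
  by move/esym/(lmP mo) => [pf _]; exact: (H _ pf).
case E: (lm gt _) => [q|//] /= qp; have := H _ (lmP mo E).1.
by case/cgt_wordW: qp => [qp|<-//] vq; exact: (gt_trans mo vq).
Qed.

Lemma wbelow_lead v h p : lead gt h p -> gt v (bword p) -> wbelow gt v h.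
Proof.
move=> lh vp q qh; have [->//|ne] := eqVneq q p.
by case/cgt_wordW: (lead_supp mo lh qh ne) => [|<-//]; exact: gt_trans vp.
Qed.

Lemma NP_nspan v h : NP h -> wbelow gt v h -> nspan v h.
Proof.
move=> Nh H; apply: span_gen; split=> //; have [p lp] := NP_lead Nh.
by exists p => //; exact/H/(lead_mem mo).
Qed.

(** The product is a normal polynomial unless [h] is a non-strong element of [T],
    and then it is a composition. *)
Lemma NP_dashv_letter h x :
  NP h -> NP (mulb 1 h (gen x)) \/ trivial_mod gt T (mulb 1 h (gen x)).
Proof.
move=> [s [B [n [Ts nh]]]]; have [p ls] := reduced_lead Ts.
case: (normal_inv mo ls nh) => [->|[m [b [ss _ ->]]]]; last first.
  by left; rewrite mulbA; apply: NP_mulb ss _ => //; left.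
have [st|ns] := boolP (strong gt s).
  by left; apply: NP_mulb (strong_slead mo ls st) _ => //; left.
by right; apply: (composition_trivial Ts Ts); exact: comp_mul_dashv.
Qed.

(** If [h] is a strong element of [T] whose leading word is not a letter, only the
    other product with a letter is normal. The two products differ only if a letter
    occurs in [h], and their difference is then a composition. *)
Lemma NP_vdash_letter h x : NP h -> span NP (mulb 2 h (gen x)).
Proof.
move=> [s [B [n [Ts nh]]]]; have [p ls] := reduced_lead Ts.
case: (normal_inv mo ls nh) => [->|[m [b [ss _ ->]]]]; last first.
  by apply: span_gen; rewrite mulbA; apply: NP_mulb ss _ => //; left.
have [st|ns] := boolP (strong gt s); last first.
  by apply: trivial_span; apply: (composition_trivial Ts Ts); exact: comp_mul_vdash.
have ss := strong_slead mo ls st.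
have [l1|l1] := ltnP 1%N (wlen (bword p)); last first.
  apply: span_gen; apply: NP_mulb ss _ => //; right.
  by split=> //; [apply/eqP; rewrite eqn_leq l1 wlen_gt0|exact: wlen_letter].
have N1 : NP (mulb 1 s (gen x)) by apply: NP_mulb ss _ => //; left.
rewrite -(subrK (mulb 1 s (gen x)) (mulb 2 s (gen x))).
apply: (subD (span_subspace _)); last exact: span_gen.
have [[y ys]|ny] := pselect (exists y, mkbasis (letter y) 1 \in msupp s).
  apply: trivial_span; apply: (composition_trivial Ts Ts).
  have lw_s : lw gt s = Some (bword p) by rewrite /lw (lead_lm mo ls).
  exact: comp_mul_diff st lw_s l1 ys.
rewrite /gen mulb21 ?subrr; first exact: span0.
move=> q qs; rewrite wlen_letter addn1 ltnS ltn_neqAle wlen_gt0 andbT.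
apply/eqP => /esym /[dup] lq /wlen1P [y ey]; apply: ny; exists y.
rewrite (_ : mkbasis _ _ = q) //; apply: basis_eq; first by rewrite bword_mk.
by rewrite [RHS]bindex1 ?lq.
Qed.

Lemma nspan_dashv v b f : nspan v f -> nspan (wmul v b) (mulb 1 f (dword1 b)).
Proof.
have letter_case w g x : nspan w g -> nspan (wmul w (letter x)) (mulb 1 g (gen x)).
  apply: (span_sub (subspace_preim (mulb_linl 1 _) (nspan_subspace _))).
  move=> h [Nh [q lh wq]].
  have := wbelow_mulb mo (m := 1) (b := letter x) (wbelow_lead lh wq).
  by case: (NP_dashv_letter x Nh); [exact: NP_nspan|exact: trivial_nspan].
elim/(@word_ind d X): b v f => [x|x b IH] v f Wf; first exact: letter_case.
by rewrite wmulA -(mulbA 1 1); apply/IH/letter_case.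
Qed.

Lemma nspan_dashvB v a b c f g : nspan v (mulb 1 f (dword1 a) - mulb 1 g (dword1 b)) ->
  nspan (wmul v c) (mulb 1 f (dword1 (wmul a c)) - mulb 1 g (dword1 (wmul b c))).
Proof.
move/(nspan_dashv c); rewrite (linmapB _ _ (mulb_linl 1 (dword1 c))).
by rewrite (mulbA 1 1 f a c) (mulbA 1 1 g b c).
Qed.

(** By associativity, multiplication by a word can be done letter by letter. *)
Lemma span_mulb m f g : m = 1%N \/ m = 2%N -> span NP f -> span NP (mulb m f g).
Proof.
have letter1 h x : span NP h -> span NP (mulb 1 h (gen x)).
  apply: (span_sub (subspace_preim (mulb_linl 1 _) (span_subspace _))) => {}h Nh.
  by case: (NP_dashv_letter x Nh); [exact: span_gen|exact: trivial_span].
have word1 h b : span NP h -> span NP (mulb 1 h (dword1 b)).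
  elim/(@word_ind d X): b h => [x|x b IH] h Nh; first exact: letter1.
  by rewrite -(mulbA 1 1); apply/IH/letter1.
move=> m12 Nf.
apply: (subspace_basis (subspace_preim (mulb_linr m f) (span_subspace _))) => q _.
rewrite mulb_word; case: m12 => ->; first exact: word1.
have [/wlen1P [x ->]|lb] := eqVneq (wlen (bword q)) 1%N.
  move: Nf; apply: (span_sub (subspace_preim (mulb_linl 2 _) (span_subspace _))).
  by move=> h; exact: NP_vdash_letter.
rewrite mulb21; first exact: word1.
by move=> r _; have := wlen_gt0 (bword r); have := wlen_gt0 (bword q); lia.
Qed.

Lemma nspan_mul_below m s p v r : T s -> slead gt s p ->
  m = 1%N \/ m = 2%N /\ wlen (bword p) = 1%N ->
  wbelow gt v r -> nspan (wmul (bword p) v) (mulb m s r).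
Proof.
move=> Ts ss hm H.
apply: (subspace_basis (subspace_preim (mulb_linr m s) (nspan_subspace _))) => q /H vq.
rewrite mulb_word.
have gen n : normal_index p (bword q) n ->
    nspan (wmul (bword p) v) (mulb n s (dword1 (bword q))).
  move=> ok; apply: NP_nspan; first exact: NP_mulb ok.
  apply: wbelow_lead (slead_lead (slead_mulb mo (m := n) (b := bword q) ss)) _.
  by rewrite bword_mk ![wmul (bword p) _]wmulC; exact: gt_wmul.
case: hm => [->|[-> lp]]; first by apply: gen; left.
have [lq|lq] := eqVneq (wlen (bword q)) 1%N; first by apply: gen; right.
rewrite mulb21; first by apply: gen; left.
by move=> r' _; have := wlen_gt0 (bword r'); have := wlen_gt0 (bword q); lia.
Qed.

(** Replacing the word of [p2] by [s2] in the first product and that of [p1] by [s1]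
    in the second turns both into the product of [s1] and [s2]; the errors are the
    products of [s1] and [s2] with the lower terms of each other. *)
Lemma nspan_swap m s1 p1 s2 p2 : T s1 -> T s2 -> slead gt s1 p1 -> slead gt s2 p2 ->
  m = 1%N \/ m = 2%N /\ (wlen (bword p1) = 1%N /\ wlen (bword p2) = 1%N) ->
  nspan (wmul (bword p1) (bword p2))
    (mulb m s1 (dword1 (bword p2)) - mulb m s2 (dword1 (bword p1))).
Proof.
move=> T1 T2 ss1 ss2 hm; rewrite -!mulb_word.
have -> : mulb m s1 << p2 >> - mulb m s2 << p1 >> =
    mulb m s2 (s1 - << p1 >>) - mulb m s1 (s2 - << p2 >>).
  rewrite !(linmapB _ _ (mulb_linr m _)) (mulbC m s2 s1) opprB.
  by rewrite [RHS]addrC addrA subrK.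
apply: (subB (nspan_subspace _)).
  by rewrite wmulC; apply: nspan_mul_below ss2 _ ss1 => //; case: hm => [|[? []]]; auto.
by apply: nspan_mul_below ss1 _ ss2 => //; case: hm => [|[? []]]; auto.
Qed.

(** If the lcm is shorter than the product of the words, the difference is a
    composition; its condition that the lengths add up to more than 3 holds because
    both cofactors are nonempty. Otherwise the words are coprime, and the cofactors
    are the words themselves. *)
Lemma nspan_lcm m s1 p1 s2 p2 (a1 a2 : word X) :
  T s1 -> T s2 -> slead gt s1 p1 -> slead gt s2 p2 -> bword p1 <> bword p2 ->
  m = 1%N \/ m = 2%N /\ (wlen (bword p1) = 1%N /\ wlen (bword p2) = 1%N) ->
  wmset (bword p1) `|` wmset (bword p2) = wmset (bword p1) `+` wmset a1 ->
  wmset (bword p1) `|` wmset (bword p2) = wmset (bword p2) `+` wmset a2 ->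
  nspan (wmul (bword p1) a1) (mulb m s1 (dword1 a1) - mulb m s2 (dword1 a2)).
Proof.
move=> T1 T2 ss1 ss2 ne hm e1 e2.
have l1 : size (wmset (bword p1) `|` wmset (bword p2)) = (wlen (bword p1) + wlen a1)%N.
  by rewrite e1 size_msetD.
have l2 : size (wmset (bword p1) `|` wmset (bword p2)) = (wlen (bword p2) + wlen a2)%N.
  by rewrite e2 size_msetD.
have g1 := wlen_gt0 a1; have g2 := wlen_gt0 a2.
have [lt|/lcm_coprime e] :=
    ltnP (size (wmset (bword p1) `|` wmset (bword p2))) (wlen (bword p1) + wlen (bword p2)).
  have gt3 : (3 < wlen (bword p1) + wlen (bword p2))%N by lia.
  case: hm => [->|]; last by lia.
  have E : wmul (bword p1) a1 = wmul (bword p2) a2.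
    by apply: val_inj; rewrite /= -e1 -e2.
  apply: trivial_nspan.
    apply: (composition_trivial T1 T2).
    apply: (@comp_inter_lcm _ _ _ _ _ _ (bword p1) (bword p2) (wmset a1) a2) => //.
    - exact: slead_strong ss1.
    - exact: slead_strong ss2.
    - by rewrite /lw (lead_lm mo (slead_lead ss1)).
    - by rewrite /lw (lead_lm mo (slead_lead ss2)).
    - by rewrite (lead_lm mo (slead_lead ss1)) (lead_lm mo (slead_lead ss2)) => -[] /(congr1 bword).
    - by apply: (normal_mulb mo ss1); left.
    - by apply: (normal_mulb mo ss2); left.
  have H1 := slead_mulb mo (m := 1) (b := a1) ss1.
  have H2 := slead_mulb mo (m := 1) (b := a2) ss2.
  by rewrite -E in H2; have := slead_diff H1 H2.
have ea1 : a1 = bword p2.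
  by apply: (@wmulI _ _ (bword p1)); apply: val_inj; rewrite /= -e1 e.
have ea2 : a2 = bword p1.
  by apply: (@wmulI _ _ (bword p2)); apply: val_inj; rewrite /= -e2 e msetDC.
by rewrite ea1 ea2; exact: nspan_swap.
Qed.

(** The leading monomial of [s1] would be that of a normal [s2]-polynomial of the
    same index. *)
Lemma reduced_no_multiple s1 p1 s2 p2 a : T s1 -> T s2 -> s1 <> s2 ->
  lead gt s1 p1 -> slead gt s2 p2 -> bword p1 = wmul (bword p2) a -> False.
Proof.
move=> T1 T2 ne ls1 ss2 e; apply: ne; apply/esym.
have ok : normal_index p2 a (bindex p1).
  case: (bindex_range p1) => [->|[-> l2]]; [by left|right].
  move: l2; rewrite e wlen_wmul.
  by have := wlen_gt0 (bword p2); have := wlen_gt0 a; split; lia.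
have ln := slead_lead (slead_mulb mo (m := bindex p1) (b := a) ss2).
apply: (reduced_irr T1 T2 ls1 (normal_mulb mo ss2 ok) ln).
by apply: basis_eq; rewrite ?(bindex_normal ok) ?bword_mk.
Qed.

(** Two strong elements of [T] may have leading monomials that share a word of
    length two and differ in the index. Their multiples by a letter form a
    composition, and those by a longer word are multiples of these. *)
Lemma nspan_same_word s1 p1 s2 p2 b : T s1 -> T s2 ->
  slead gt s1 p1 -> slead gt s2 p2 -> bword p1 = bword p2 -> p1 <> p2 ->
  nspan (wmul (bword p1) b) (mulb 1 s1 (dword1 b) - mulb 1 s2 (dword1 b)).
Proof.
move=> T1 T2 ss1 ss2 eu np; have ls1 := slead_lead ss1; have ls2 := slead_lead ss2.
have l2 : wlen (bword p1) = 2%N.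
  apply/eqP; apply/contraT => nl; case: np; apply: basis_eq => //.
  by rewrite !bindex1 -?eu.
have at_letter x : nspan (wmul (bword p1) (letter x)) (mulb 1 s1 (gen x) - mulb 1 s2 (gen x)).
  apply: trivial_nspan.
    apply: (composition_trivial T1 T2).
    apply: (@comp_inter_eq _ _ _ _ _ _ (bword p1) x) => //.
    - exact: slead_strong ss1.
    - exact: slead_strong ss2.
    - by rewrite /lw (lead_lm mo ls1).
    - by rewrite /lw (lead_lm mo ls2) /= eu.
    - by rewrite l2.
    - by rewrite (lead_lm mo ls1) (lead_lm mo ls2) => -[].
    - by apply: (normal_mulb mo (b := letter x) ss1); left.
    - by apply: (normal_mulb mo (b := letter x) ss2); left.
  have H1 := slead_mulb mo (m := 1) (b := letter x) ss1.
  have H2 := slead_mulb mo (m := 1) (b := letter x) ss2.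
  by rewrite -eu in H2; have := slead_diff H1 H2.
elim/(@word_ind d X): b => [//|x b _].
by rewrite wmulA; apply: nspan_dashvB.
Qed.

(** Both products are multiples of those up to the lcm [L] of the two leading
    words. The cofactors of [L] are nonempty, since in a reduced set neither
    leading word divides the other. *)
Lemma nspan_distinct_words n s1 p1 s2 p2 b1 b2 : T s1 -> T s2 -> s1 <> s2 ->
  slead gt s1 p1 -> slead gt s2 p2 ->
  normal_index p1 b1 n -> normal_index p2 b2 n ->
  bword p1 <> bword p2 -> wmul (bword p1) b1 = wmul (bword p2) b2 ->
  nspan (wmul (bword p1) b1) (mulb n s1 (dword1 b1) - mulb n s2 (dword1 b2)).
Proof.
move=> T1 T2 ne ss1 ss2 ok1 ok2 nu eb.
have ls1 := slead_lead ss1; have ls2 := slead_lead ss2.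
pose L := wmset (bword p1) `|` wmset (bword p2).
have dv1 : wmset (bword p1) `<=` L by exact: msubsetUl.
have dv2 : wmset (bword p2) `<=` L by exact: msubsetUr.
have LE1 := msetBDKC dv1; have LE2 := msetBDKC dv2.
have a1n : L `\` wmset (bword p1) != mset0.
  apply/eqP => z; have a2n : L `\` wmset (bword p2) != mset0.
    apply/eqP => z2; apply: nu; apply: val_inj => /=.
    by rewrite -[LHS]msetD0 -z LE1 -LE2 z2 msetD0.
  apply: (@reduced_no_multiple s1 p1 s2 p2 (Word a2n)) => //.
  by apply: val_inj; rewrite /= LE2 -LE1 z msetD0.
have a2n : L `\` wmset (bword p2) != mset0.
  apply/eqP => z; apply: (@reduced_no_multiple s2 p2 s1 p1 (Word a1n)) => //.
    by move=> e; apply: ne.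
  by apply: val_inj; rewrite /= LE1 -LE2 z msetD0.
have Lw : L `<=` wmset (wmul (bword p1) b1).
  rewrite msubUset {2}eb; apply/andP; split; apply/msubsetP => x;
    by rewrite /= msetE2 leq_addr.
have LEc := msetBDKC Lw.
have Eb1 : wmset b1 = wmset (Word a1n) `+` (wmset (wmul (bword p1) b1) `\` L).
  by apply: (can_inj (msetDKB (wmset (bword p1)))); rewrite msetDA LE1 LEc.
have Eb2 : wmset b2 = wmset (Word a2n) `+` (wmset (wmul (bword p1) b1) `\` L).
  by apply: (can_inj (msetDKB (wmset (bword p2)))); rewrite msetDA LE2 LEc eb.
have [z|cn] := eqVneq (wmset (wmul (bword p1) b1) `\` L) mset0.
  have -> : b1 = Word a1n by apply: val_inj; rewrite /= Eb1 z msetD0.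
  have -> : b2 = Word a2n by apply: val_inj; rewrite /= Eb2 z msetD0.
  apply: nspan_lcm nu _ _ _ => //=.
  case: ok1 ok2 => [-> _|[-> w1 _] [//|[_ w2 _]]]; [by left|by right].
have [c e1 e2] : exists2 c, b1 = wmul (Word a1n) c & b2 = wmul (Word a2n) c.
  by exists (Word cn); apply: val_inj.
have -> : n = 1%N.
  case: ok1 => // -[_ _]; rewrite e1 wlen_wmul.
  by have := wlen_gt0 (Word a1n); have := wlen_gt0 c; lia.
rewrite e1 e2 wmulA; apply: nspan_dashvB.
by apply: nspan_lcm nu _ _ _ => //=; left.
Qed.

(** Normal polynomials of one element of [T] with the same leading monomial are
    equal. For two elements, reducedness forces both to be properly multiplied, and
    the claim depends on their leading words. *)
Lemma NP_diff h1 h2 p :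
  NP h1 -> NP h2 -> lead gt h1 p -> lead gt h2 p -> nspan (bword p) (h1 - h2).
Proof.
move=> [s1 [B1 [m1 [T1 nh1]]]] [s2 [B2 [m2 [T2 nh2]]]] lh1 lh2.
have [p1 ls1] := reduced_lead T1; have [p2 ls2] := reduced_lead T2.
have [es|ne] := pselect (s1 = s2).
  rewrite -es in nh2; rewrite (normal_lead_inj mo ls1 nh1 nh2 lh1 lh2) subrr.
  exact: span0.
case: (normal_inv mo ls1 nh1) => [e1|[n1 [b1 [ss1 ok1 e1]]]].
  case: ne; apply/esym; apply: (reduced_irr T1 T2 ls1 nh2 lh2).
  by rewrite e1 in lh1; exact: lead_inj lh1.
case: (normal_inv mo ls2 nh2) => [e2|[n2 [b2 [ss2 ok2 e2]]]].
  case: ne; apply: (reduced_irr T2 T1 ls2 nh1 lh1).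
  by rewrite e2 in lh2; exact: lead_inj lh2.
have ep1 := slead_lead (slead_mulb mo (m := n1) (b := b1) ss1).
have ep2 := slead_lead (slead_mulb mo (m := n2) (b := b2) ss2).
rewrite -e1 in ep1; rewrite -e2 in ep2.
have E1 := lead_inj mo lh1 ep1; have E2 := lead_inj mo lh2 ep2.
have en : n1 = n2 by rewrite -(bindex_normal ok1) -(bindex_normal ok2) -E1 -E2.
subst n2; rewrite e1 e2.
have eb : wmul (bword p1) b1 = wmul (bword p2) b2.
  by have := congr1 bword E2; rewrite {1}E1.
rewrite E1 bword_mk.
have [eu|nu] := pselect (bword p1 = bword p2); last first.
  exact: (nspan_distinct_words T1 T2 ne ss1 ss2 ok1 ok2 nu eb).
rewrite eu in eb; move/wmulI: eb => eb; subst b2.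
have np : p1 <> p2.
  move=> e; apply: ne; apply/esym.
  exact: (reduced_irr T1 T2 ls1 (normal_self mo ls2) ls2).
have -> : n1 = 1%N.
  (* For n1 = 2 both leading monomials would be the same letter. *)
  case: ok1 => // -[_ l1 _]; case: np; apply: basis_eq => //.
  by rewrite !bindex1 // -?eu l1.
exact: (nspan_same_word _ T1 T2 ss1 ss2 eu np).
Qed.

Definition pspan (Q : basis X -> Prop) : Di -> Prop :=
  span (fun h => NP h /\ exists2 p, lead gt h p & Q p).

(** In this form the leading monomial of [f] is visible: all normal polynomials with
    the largest leading monomial have been merged into one. *)
Definition topped (Q : basis X -> Prop) f : Prop :=
  f = 0 \/ exists h p (c : k),
    [/\ NP h, lead gt h p, Q p, c != 0 & pspan (cgt p) (f - c *: h)].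

Lemma pspan_mono (Q Q' : basis X -> Prop) f :
  (forall p, Q p -> Q' p) -> pspan Q f -> pspan Q' f.
Proof.
move=> QQ'; apply: (span_sub (span_subspace _)) => h [Nh [p lp /QQ' Qp]].
by apply: span_gen; split=> //; exists p.
Qed.

(** When the leading terms of two summands cancel, the sum is a combination of
    smaller normal polynomials, to which the second hypothesis applies. *)
Lemma topped_step (Q : basis X -> Prop) f :
  (forall p q, Q p -> cgt p q -> Q q) ->
  (forall p g, Q p -> pspan (cgt p) g -> topped (cgt p) g) ->
  pspan Q f -> topped Q f.
Proof.
move=> Qdown IHp; elim=> [|c0 h0 {}f [Nh0 [p0 lp0 Qp0]] _ IH]; first by left.
have [->|c00] := eqVneq c0 0; first by rewrite scale0r add0r.
case: IH => [->|[h [p [c [Nh lp Qp cn0 V]]]]].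
  by right; exists h0, p0, c0; split=> //; rewrite addr0 subrr; exact: span0.
case: (eqVneq p0 p) lp0 => [->|ne] lp0.
  have E : c0 *: h0 + f = (c0 + c) *: h + (c0 *: (h0 - h) + (f - c *: h)).
    rewrite scalerDl scalerBr [RHS]addrACA.
    by congr (_ + _); rewrite [RHS]addrC subrK.
  have V' : pspan (cgt p) (c0 *: (h0 - h) + (f - c *: h)).
    case: (span_subspace (fun h => NP h /\ exists2 q, lead gt h q & cgt p q)) => _; apply=> //.
    apply: span_sub (NP_diff Nh0 Nh lp0 lp); first exact: span_subspace.
    move=> h1 [N1 [q lq pq]]; apply: span_gen; split=> //; exists q => //.
    exact: cgt_word.
  have [cc0|cc0] := eqVneq (c0 + c) 0; last first.
    by right; exists h, p, (c0 + c); rewrite E [_ + _ - _]addrC addKr; split.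
  rewrite E cc0 scale0r add0r; case: (IHp p _ Qp V'); first by left.
  move=> [h1 [p1 [c1 [N1 l1 pp1 n1 V1]]]]; right; exists h1, p1, c1; split=> //.
  exact: Qdown pp1.
right; case/orP: (cgt_total mo ne) => g.
  exists h0, p0, c0; rewrite [_ + _ - _]addrC addKr; split=> {IHp Qdown}//.
  rewrite -(subrK (c *: h) f) addrC; apply: spanS; first by split=> //; exists p.
  by apply: pspan_mono V => q; exact: (cgt_trans mo g).
exists h, p, c; split=> //; rewrite -addrA; apply: spanS => //.
by split=> //; exists p0.
Qed.

Lemma topped_below p f : pspan (cgt p) f -> topped (cgt p) f.
Proof.
move: p f; apply: (well_founded_ind (cgt_wf mo)) => p IH f.
apply: topped_step => [q r pq qr|q g pq]; first exact: (cgt_trans mo pq qr).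
exact: IH.
Qed.

Lemma NP_lm f : span NP f -> f != 0 -> exists2 h, NP h & lm gt h = lm gt f.
Proof.
move=> Nf f0; have : pspan (fun=> True) f.
  apply: span_sub Nf => [|h Nh]; first exact: span_subspace.
  by apply: span_gen; split=> //; have [p lp] := NP_lead Nh; exists p.
case/topped_step => [//|p g _|f0'|[h [p [c [Nh lp _ c0 V]]]]].
- exact: topped_below.
- by rewrite f0' eqxx in f0.
exists h => //; rewrite (lead_lm mo lp); apply/esym.
have -> : f = c *: << p >> + (c *: (h - << p >>) + (f - c *: h)).
  by rewrite scalerBr addrA [c *: << p >> + _]addrC subrK addrC subrK.
apply: (lm_dominant mo c0); case: (below_subspace gt (k := k) p) => _; apply=> //.
apply: span_sub V; first exact: below_subspace.
move=> h1 [_ [q lq pq]] r r1; have [->//|ne] := eqVneq r q.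
exact: (cgt_trans mo pq (lead_supp mo lq r1 ne)).
Qed.

Lemma Id_span f : Id T f -> span NP f.
Proof.
apply: smallest_sub => [|s Ts]; last exact/span_gen/NP_self.
have [S0 SD] := span_subspace NP; split=> // g h Ng; split.
- by apply: (span_mulb (m := 2)) => //; right.
- by rewrite -[vdash h g]/(mulb 2 h g) mulbC; apply: (span_mulb (m := 2)) => //; right.
- by apply: (span_mulb (m := 1)) => //; left.
- by rewrite -[dashv h g]/(mulb 1 h g) mulbC; apply: (span_mulb (m := 1)) => //; left.
Qed.

Lemma Id_lm f : Id T f -> f != 0 -> exists2 h, NP h & lm gt h = lm gt f.
Proof. by move/Id_span; exact: NP_lm. Qed.

End Diamond.

(** * Kernels of well-founded relations *)

Section Kernel.
Context {A : Type} (D : set A) (E : A -> A -> Prop) (wfE : well_founded E).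

(** The notion of kernel of a directed graph, relative to the vertices in [D]. *)
Definition kernel (M : set A) : Prop := forall a, M a <-> D a /\ forall b, E b a -> ~ M b.

Lemma kernel_exists : exists M, kernel M.
Proof.
pose step a (rec : forall b, E b a -> Prop) := D a /\ forall b (e : E b a), ~ rec b e.
exists (Fix wfE (fun=> Prop) step) => a.
rewrite Fix_eq // => b f g fg; congr (step b _).
by apply: functional_extensionality_dep => c; apply: functional_extensionality_dep.
Qed.

Lemma kernel_unique M M' : kernel M -> kernel M' -> M = M'.
Proof.
move=> kM kM'; apply/seteqP.
suff H a : M a <-> M' a by split=> a /H.
move: a; apply: (well_founded_ind wfE) => a IH; rewrite kM kM'.
by split=> -[Da H]; split=> // b e /(IH b e); exact: H.
Qed.

End Kernel.

(** * Canonical elements of an ideal *)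

Section Canonical.
Context {d : Order.disp_t} {X : orderType d} {k : fieldType}.
Context (gt : rel (word X)) (mo : monomial_ordering gt).
Local Notation Di := (Di X k).
Local Notation cgt := (center_gt gt).
Implicit Types (f g h r s : Di) (p q : basis X).

Context (I : set Di) (idI : ideal I).

Definition leads p : Prop := exists2 f, I f & lm gt f = Some p.

Definition canonical f : Prop :=
  I f /\ exists2 p, lead gt f p & forall q, q \in msupp (f - << p >>) -> ~ leads q.

Let subI : subspace I := ideal_subspace idI.

Lemma leads_monic p : leads p -> exists2 f, I f & lead gt f p.
Proof.
case=> f If lf; have [c0 H] := below_rest mo lf.
exists ((f@_p)^-1 *: f); first exact: subZ.
rewrite /lead.
have -> : (f@_p)^-1 *: f - << p >> = (f@_p)^-1 *: (f - f@_p *: << p >>).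
  by rewrite scalerBr scalerA mulVf // scale1r.
exact: (subZ (below_subspace gt p)).
Qed.

(** The leading monomial is either cancelled with a monic element of [I], or kept if
    there is none; the rest is smaller. *)
Lemma normal_form p f : below gt p f ->
  exists g, [/\ I (f - g), below gt p g & forall q, q \in msupp g -> ~ leads q].
Proof.
move: p f; apply: (well_founded_ind (cgt_wf mo)) => p IH f bf.
have [->|/(lm_neq0 mo) [q lf]] := eqVneq f 0.
  exists 0; split; first by rewrite subrr; exact: sub0.
  - exact: (sub0 (below_subspace gt p)).
  - by move=> q; rewrite msupp0.
have [c0 H] := below_rest mo lf; have pq := bf _ (lmP mo lf).1.
set c := f@_q in c0 H.
have [/leads_monic [e Ie le]|nq] := pselect (leads q).
  have : below gt q (f - c *: e).
    have -> : f - c *: e = (f - c *: << q >>) - c *: (e - << q >>).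
      by rewrite scalerBr opprB addrA subrK.
    by apply: (subB (below_subspace gt q)) => //; exact: (subZ (below_subspace gt q)).
  case/(IH _ pq) => g [Ig bg ng]; exists g; split=> //; last exact: below_trans bg.
  have -> : f - g = (f - c *: e - g) + c *: e by rewrite addrAC subrK.
  by apply: (subD subI) => //; exact: subZ.
have [g [Ig bg ng]] := IH _ pq _ H.
exists (c *: << q >> + g); split; first by rewrite opprD addrA.
  case: (below_subspace gt (k := k) p) => _; apply; last exact: below_trans bg.
  by move=> r; rewrite msuppU oner_eq0 inE => /eqP ->.
case: (supp_subspace (k := k) (fun q => ~ leads q)) => _; apply=> //.
by move=> r; rewrite msuppU oner_eq0 inE => /eqP ->.
Qed.

Lemma canonical_exists p : leads p -> exists2 f, canonical f & lead gt f p.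
Proof.
case/leads_monic => e Ie le; have [g [Ig bg ng]] := normal_form le.
exists (<< p >> + g); last by rewrite /lead addrC addKr.
split; last by exists p; rewrite ?/lead addrC addKr.
have -> : << p >> + g = e - (e - << p >> - g).
  by rewrite !opprB addrCA [e + _]addrC subrK addrC.
exact: subB.
Qed.

Lemma canonical_inj f g : canonical f -> canonical g -> lm gt f = lm gt g -> f = g.
Proof.
case=> If [p lf nf] [Ig [q lg ng]].
rewrite (lead_lm mo lf) (lead_lm mo lg) => -[epq]; subst q.
apply/eqP; rewrite -subr_eq0; apply/negPn/negP => /(lm_neq0 mo) [r lr].
have /(_ r (lmP mo lr).1) : forall q, q \in msupp (f - g) -> ~ leads q.
  have := subB (supp_subspace (fun q => ~ leads q)) nf ng.
  by rewrite opprB addrA subrK.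
by apply; exists (f - g) => //; exact: subB.
Qed.

Definition reduces s f : Prop :=
  [/\ canonical s, canonical f, s <> f &
      exists h B m, normal gt s B m h /\ lm gt h = lm gt f].

Lemma reduces_wf : well_founded reduces.
Proof.
have H p : forall f, lead gt f p -> Acc reduces f.
  move: p; apply: (well_founded_ind (cgt_wf mo)) => p IH f lf.
  constructor => s [cs cf ne [h [B [m [nh]]]]]; rewrite (lead_lm mo lf) => lh.
  case: (cs) => _ [q ls _]; have [r [lr dr]] := normal_lead mo ls nh.
  move: lh; rewrite (lead_lm mo lr) => -[er]; subst r.
  case: dr => [eh|g]; last exact: IH g _ ls.
  by case: ne; apply: canonical_inj => //; rewrite -eh (lead_lm mo lr) (lead_lm mo lf).
move=> f; constructor => s [[_ [p ls _]] _ _ _]; exact: H ls.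
Qed.

(** An element [s] of [T] is canonical: if another monomial of [s] were leading in
    [I], it would be so for a normal polynomial, not of another element as [T] is
    reduced, and not of [s] as it is smaller than the leading monomial of [s]. *)
Lemma reduced_kernel T : reduced_GSbasis gt T -> Id T = I ->
  kernel canonical reduces T.
Proof.
move=> redT eT.
have TI s : T s -> I s by rewrite -eT => Ts; exact: sub_gen_smallest.
have CD p : leads p -> exists s B m h, [/\ T s, normal gt s B m h & lm gt h = Some p].
  case=> f If lf; have f0 : f != 0.
    by apply/eqP => f0; move: lf; rewrite f0 /lm msupp0.
  have [|h [s [B [m [Ts nh]]]] lh] := Id_lm mo redT _ f0; first by rewrite eT.
  by exists s, B, m, h; split=> //; rewrite lh.
have Tcan s : T s -> canonical s.
  move=> Ts; split; first exact: TI.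
  have [p ls] := reduced_lead mo redT Ts; exists p => // q qr lq.
  have pq := ls q qr.
  have qs : q \in msupp s.
    move: qr; rewrite -!mcoeff_neq0 mcoeffB mcoeffU.
    have [epq|_] := eqVneq p q; last by rewrite mulr0n subr0.
    by move: pq; rewrite epq (cgt_irr mo).
  have [s' [B [m [h [Ts' nh lh]]]]] := CD q lq.
  have es : s' = s.
    apply: contrapT => ne; case: redT => _ /(_ s Ts q qs h); apply=> //.
    by exists s', B, m.
  subst s'; have [r [lr dr]] := normal_lead mo ls nh.
  move: lh; rewrite (lead_lm mo lr) => -[er]; subst r.
  case: dr => [eh|qp]; last by rewrite (cgt_asym mo pq) in qp.
  by move: pq; rewrite eh in lr; rewrite (lead_inj mo ls lr) (cgt_irr mo).
move=> f; split=> [Tf|[cf nred]].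
  split=> [|s [cs _ ne [h [B [m [nh lh]]]]] Ts]; first exact: Tcan.
  have [p lf] := reduced_lead mo redT Tf; apply: ne.
  rewrite (lead_lm mo lf) in lh.
  apply: contrapT => ne; case: redT => _ /(_ f Tf p (lead_mem mo lf) h); apply=> //.
  by exists s, B, m.
case: (cf) => If [p lf _].
have [|s [B [m [h [Ts nh lh]]]]] := CD p; first by exists f => //; exact: lead_lm.
have [<-//|ne] := pselect (s = f).
case: (nred s) => //; split=> //; first exact: Tcan.
by exists h, B, m; split=> //; rewrite (lead_lm mo lf).
Qed.

(** A canonical element outside the kernel is reduced by one inside, so every leading
    monomial of [I] is one of a normal [S]-polynomial and division by [S] ends with
    remainder 0 on all of [I]. *)
Lemma kernel_reduced S : kernel canonical reduces S ->
  reduced_GSbasis gt S /\ Id S = I.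
Proof.
move=> kS.
have Scan s : S s -> canonical s by case/kS.
have Slead s : S s -> exists p, lead gt s p by case/Scan => _ [p ls _]; exists p.
have NI h : normal_poly gt S h -> I h.
  move=> [s [B [m [Ss nh]]]]; have [p ls] := Slead s Ss.
  by apply: normal_ideal ls nh => //; case: (Scan s Ss).
have red p : leads p -> exists2 h, normal_poly gt S h & lead gt h p.
  case/canonical_exists => f cf lf.
  have [Sf|nS] := pselect (S f).
    by exists f => //; exists f, mset0, (bindex p); split=> //; exact: normal_self.
  have [s [[cs _ _ [h [B [m [nh lh]]]]] Ss]] : exists s, reduces s f /\ S s.
    apply: contrapT => H; apply: nS; apply/kS; split=> // s sf Ss; apply: H.
    by exists s.
  have [q ls] := Slead s Ss; have [r [lr _]] := normal_lead mo ls nh.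
  move: lh; rewrite (lead_lm mo lr) (lead_lm mo lf) => -[er]; subst r.
  by exists h => //; exists s, B, m.
have triv f : I f -> trivial_mod gt S f.
  have [->|] := eqVneq f 0; first by move=> _; exists [::]; split=> //; rewrite big_nil.
  case/(lm_neq0 mo) => p; move: p f.
  apply: (well_founded_ind (cgt_wf mo)) => p IH f lf If.
  have [h Nh lh] : exists2 h, normal_poly gt S h & lead gt h p by apply: red; exists f.
  have [c0 bf] := below_rest mo lf; set c := f@_p in c0 bf.
  have bg : below gt p (f - c *: h).
    have -> : f - c *: h = (f - c *: << p >>) - c *: (h - << p >>).
      by rewrite scalerBr opprB addrA subrK.
    by apply: (subB (below_subspace gt p)) => //; exact: (subZ (below_subspace gt p)).
  have Ig : I (f - c *: h) by apply: (subB subI) => //; apply: (subZ subI); exact: NI.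
  have hf : lm_le gt h f by left; rewrite (lead_lm mo lh).
  have [e|/(lm_neq0 mo) [q lq]] := eqVneq (f - c *: h) 0.
    exists [:: (c, h)]; split=> [g|g|]; rewrite ?mem_seq1.
    - by move/eqP ->.
    - by move/eqP ->.
    - by rewrite big_seq1; apply/eqP; rewrite -subr_eq0 e.
  have pq := bg _ (lmP mo lq).1.
  have [r [rN rle er]] := IH _ pq _ lq Ig.
  exists ((c, h) :: r); split=> [g|g|].
  - by rewrite inE => /orP[/eqP ->//|]; exact: rN.
  - rewrite inE => /orP[/eqP ->//|gr g0]; right.
    case: (rle g gr g0) => [->|]; first by rewrite lq lf.
    rewrite lq lf /=; case: (lm gt g.2) => //= t; exact: (cgt_trans mo pq).
  - by rewrite big_cons -er addrC subrK.
split; last first.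
  apply/seteqP; split=> f.
    by apply: smallest_sub => // s /Scan [].
  move=> /triv [r [rN _ ->]] J [idJ SJ].
  apply: (sub_sum (ideal_subspace idJ)) => g /rN [s [B [m [Ss nh]]]].
  apply: (subZ (ideal_subspace idJ)); have [p ls] := Slead s Ss.
  by apply: normal_ideal ls nh => //; exact: SJ.
have [I0 _ Iv Id'] := idI.
have nI f B m h : S f -> normal gt f B m h -> I h.
  by move=> Sf nh; apply: NI; exists f, B, m.
split; first split=> [s /Slead [p]|f g h Sf Sg c]; first exact: lead_monic.
  have If : I f by case: (Scan f Sf).
  have Ig : I g by case: (Scan g Sg).
  apply: triv; case: c.
  - by move=> x _; case: (Iv f (gen x) If).
  - by move=> x _; case: (Id' f (gen x) If).
  - by move=> u x y *; apply: (subB subI); [case: (Iv f (gen x) If)|case: (Id' f (gen x) If)].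
  - by move=> *; exact: subB.
  - by move=> u v x m h' _ _ _ _ nh _; apply: (subB subI) => //; exact: nI nh.
  - by move=> u x h1 h2 _ _ _ _ _ _ n1 n2; apply: (subB subI); [exact: nI n1|exact: nI n2].
  - move=> u v a b h1 h2 _ _ _ _ _ _ _ _ _ _ n1 n2.
    by apply: (subB subI); [exact: nI n1|exact: nI n2].
move=> s Ss p ps h [t [B [m [[St ne] nh]]]] lh.
have [q ls] := Slead s Ss; have [cs nred] := (kS s).1 Ss.
have [epq|npq] := eqVneq p q.
  apply: (nred t) => //; split=> //; first exact: Scan.
  by exists h, B, m; split=> //; rewrite (lead_lm mo ls) lh epq.
case: cs => _ [q' ls' nl]; rewrite (lead_inj mo ls' ls) in nl.
apply: (nl p); last by exists h => //; exact: nI nh.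
by rewrite -mcoeff_neq0 mcoeffB mcoeffU [q == p]eq_sym (negPf npq) mulr0n subr0 mcoeff_neq0.
Qed.

End Canonical.

Theorem theorem19 (d : Order.disp_t) (X : orderType d) (k : fieldType)
    (I : set (Di X k)) (gt : rel (word X)) :
  ideal I -> monomial_ordering gt ->
  exists! S : set (Di X k), reduced_GSbasis gt S /\ Id S = I.
Proof.
move=> idI mo.
have [S kS] := kernel_exists (canonical gt I) (reduces_wf mo idI).
exists S; split=> [|T [redT eT]]; first exact: kernel_reduced.
apply: (kernel_unique (reduces_wf mo idI) kS); exact: reduced_kernel.
Qed.
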